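(* Let $P(\lambda)=\lambda(J_1+R_1)+(J_2+R_2)\in\mathbb C^{n,n}[\lambda]$, where $J_i^*=-J_i$ and $R_i^*=R_i\ge 0$ for $i=1,2$, be such that $$-(x^*R_1x)(x^*R_2x)+(x^*J_1x)(x^*J_2x)\le 0\quad\text{for all }x\in\mathbb C^n.$$ If $P(\lambda)$ is a regular pencil, and $\lambda J_1+J_2$ has all minimal indices equal to zero (if there are any) and all its (finite) eigenvalues in the closed left half-plane, then all the (finite) eigenvalues of $P(\lambda)$ are contained in the closed left half-plane.
   Context: $M^*$ denotes the conjugate transpose, $M\ge 0$ means Hermitian positive semidefinite. A square pencil is regular if its determinant is not identically zero. Kronecker canonical form: every pencil is equivalent, under multiplication from left and right by constant invertible complex matrices, to a block diagonal pencil, unique up to block permutation, with blocks $\mathcal L_\epsilon=\lambda[\,I_\epsilon\;0\,]-[\,0\;I_\epsilon\,]$ of size $\epsilon\times(\epsilon+1)$ ($\epsilon\ge0$), transposed blocks $\mathcal L_\eta^\top$ of size $(\eta+1)\times\eta$ ($\eta\ge 0$), blocks $\lambda I_\rho-\mathcal J_\rho(\lambda_i)$ and blocks $\lambda\mathcal J_\sigma(0)-I_\sigma$, where $\mathcal J_k(\lambda_0)$ is the $k\times k$ Jordan block. The numbers $\epsilon$ and $\eta$ are the (right and left) minimal indices; the $\lambda_i$ are the finite eigenvalues (also when the pencil is singular). *)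

(* Defs.v *)
From mathcomp Require Import all_boot all_order all_algebra.
From mathcomp Require Import reals.
From mathcomp Require Export complex.

Set Implicit Arguments.
Unset Strict Implicit.
Unset Printing Implicit Defensive.

Import Order.TTheory GRing.Theory Num.Theory.
Local Open Scope ring_scope.
Local Open Scope complex_scope.
Local Open Scope sesquilinear_scope.

Section Pencils.
Variable C : numClosedFieldType.

(* [pencil A B] is lambda A + B, with lambda rendered as 'X. *)
Definition pencil m n (A B : 'M[C]_(m, n)) : 'M[{poly C}]_(m, n) :=
  'X *: map_mx polyC A + map_mx polyC B.

Definition regular_pencil n (P : 'M[{poly C}]_n) : Prop := \det P != 0.

Definition qform n (M : 'M[C]_n) (x : 'cV[C]_n) : C := (x^t* *m M *m x) 0 0.

Definition psdmx n (M : 'M[C]_n) : Prop :=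
  M^t* = M /\ forall x : 'cV[C]_n, 0 <= qform M x.

Definition jordan_mx k (a : C) : 'M[C]_k :=
  \matrix_(i < k, j < k) (a *+ (j == i :> nat) + 1 *+ (j == i.+1 :> nat)).

(* [KFin r a] and [KInf s] have sizes r.+1 and s.+1: Jordan blocks are
   nonempty, so that a block cannot contribute a spurious eigenvalue. *)
Inductive kblock : Type :=
  | KRight (eps : nat)
  | KLeft (eta : nat)
  | KFin (r : nat) (a : C)
  | KInf (s : nat).

Definition kb_rows (b : kblock) : nat :=
  match b with
  | KRight eps => eps
  | KLeft eta => eta.+1
  | KFin r _ => r.+1
  | KInf s => s.+1
  end.

Definition kb_cols (b : kblock) : nat :=
  match b with
  | KRight eps => eps.+1
  | KLeft eta => eta
  | KFin r _ => r.+1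
  | KInf s => s.+1
  end.

(* lambda [I_e 0] - [0 I_e] *)
Definition kronecker_block e : 'M[{poly C}]_(e, e.+1) :=
  pencil (\matrix_(i < e, j < e.+1) (j == i :> nat)%:R)
         (- \matrix_(i < e, j < e.+1) (j == i.+1 :> nat)%:R).

Definition kb_mx (b : kblock) : 'M[{poly C}]_(kb_rows b, kb_cols b) :=
  match b return 'M[{poly C}]_(kb_rows b, kb_cols b) with
  | KRight eps => kronecker_block eps
  | KLeft eta => (kronecker_block eta)^T
  | KFin r a => pencil 1%:M (- jordan_mx r.+1 a)
  | KInf s => pencil (jordan_mx s.+1 0) (- 1%:M)
  end.

Fixpoint kcf_rows (K : seq kblock) : nat :=
  if K is b :: K' then (kb_rows b + kcf_rows K')%N else 0%N.

Fixpoint kcf_cols (K : seq kblock) : nat :=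
  if K is b :: K' then (kb_cols b + kcf_cols K')%N else 0%N.

Fixpoint kcf_mx (K : seq kblock) : 'M[{poly C}]_(kcf_rows K, kcf_cols K) :=
  match K return 'M[{poly C}]_(kcf_rows K, kcf_cols K) with
  | [::] => 0
  | b :: K' => block_mx (kb_mx b) 0 0 (kcf_mx K')
  end.

(* Such a K exists for every pencil P = pencil A B and is unique up to the
   order of its blocks (Kronecker); minimal indices and finite eigenvalues are
   therefore read off from any K with [kronecker_form P K]. *)
Definition kronecker_form m n (P : 'M[{poly C}]_(m, n)) (K : seq kblock) :
    Prop :=
  exists (em : kcf_rows K = m) (en : kcf_cols K = n)
         (S : 'M[C]_m) (T : 'M[C]_n),
    [/\ S \in unitmx, T \in unitmx &
        map_mx polyC S *m P *m map_mx polyC T = castmx (em, en) (kcf_mx K)].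

(* Right and left minimal indices together. *)
Definition minimal_indices (K : seq kblock) : seq nat :=
  pmap (fun b => match b with
                 | KRight eps => Some eps
                 | KLeft eta => Some eta
                 | _ => None
                 end) K.

Definition finite_eigenvalues (K : seq kblock) : seq C :=
  pmap (fun b => if b is KFin _ a then Some a else None) K.

End Pencils.

(* Main.v *)
Require Import Defs.
From mathcomp Require Import all_boot all_order all_algebra.
From mathcomp Require Import reals complex ring.

Import Order.TTheory GRing.Theory Num.Theory.
Local Open Scope ring_scope.
Local Open Scope sesquilinear_scope.

(** Let [P(mu) x = 0] with [x <> 0], and let [x^* J_k x = j_k] (purely
    imaginary) and [x^* R_k x = r_k >= 0].  Multiplying [P(mu) x = 0] by [x^*]
    gives [mu (j1 + r1) + (j2 + r2) = 0].

    If [j1 + r1 <> 0], this equation determines [mu], and the real part of [mu]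
    times [|j1 + r1|^2] is exactly [- r1 r2 + j1 j2], which the hypothesis on
    the quadratic forms makes nonpositive ([Re_le0_of_numerical]).

    If [j1 + r1 = 0], then also [j2 + r2 = 0].  Real and imaginary parts
    separate, so [r1 = r2 = 0], and semidefiniteness gives [R1 x = R2 x = 0]
    ([skew_psd_qform_eq0]).  Hence [(mu J1 + J2) x = 0].  Either [mu] is a
    finite eigenvalue of [lambda J1 + J2], where the real part is nonpositive
    by hypothesis, or it is not.  In the second case the only blocks of the
    Kronecker form of [lambda J1 + J2] that are not injective at [mu] are zero
    columns, because every minimal index is zero; so [x] lies in the kernel of
    [lambda J1 + J2] for every [lambda], that is [J1 x = J2 x = 0]
    ([kernel_const_of_indices0]).  Then [P(lambda) x = 0] for every [lambda],
    which contradicts regularity ([regular_pencil_ker0]). *)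

(** * Evaluating pencils *)

Local Notation mxeval mu := (map_mx (horner_eval mu)).

Lemma mxeval_pencil {C : numClosedFieldType} {m n : nat} (A B : 'M[C]_(m, n))
    (mu : C) :
  mxeval mu (pencil A B) = mu *: A + B.
Proof. by apply/matrixP => i j; rewrite !mxE horner_evalE !hornerE. Qed.

Lemma mxeval_const {C : numClosedFieldType} {m n : nat} (A : 'M[C]_(m, n))
    (mu : C) :
  mxeval mu (map_mx polyC A) = A.
Proof. by apply/matrixP => i j; rewrite !mxE horner_evalE hornerC. Qed.

(** A common kernel vector of the two coefficients is killed by the polynomial
    matrix [pencil A B]; multiplying by the adjugate shows that the nonzero
    determinant kills it too, over an integral domain. *)
Lemma regular_pencil_ker0 {C : numClosedFieldType} {n : nat}
    (A B : 'M[C]_n) (x : 'cV[C]_n) :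
  regular_pencil (pencil A B) -> A *m x = 0 -> B *m x = 0 -> x = 0.
Proof.
move=> detP Ax Bx; apply/matrixP => i j.
have Px0 : pencil A B *m map_mx polyC x = 0.
  by rewrite mulmxDl -scalemxAl -!map_mxM Ax Bx !map_mx0 scaler0 addr0.
have /matrixP/(_ i j) : \det (pencil A B) *: map_mx polyC x = 0.
  by rewrite -mul_scalar_mx -mul_adj_mx -mulmxA Px0 mulmx0.
by rewrite !mxE => /eqP; rewrite mulf_eq0 (negbTE detP) polyC_eq0 => /eqP.
Qed.

(** * Kernels of Kronecker forms *)

(** Both kinds of regular Kronecker blocks, evaluated at a point, have this
    shape. *)
Lemma det_bidiagonal {C : comPzRingType} {k : nat} (a b : C) :
  \det (\matrix_(i < k, j < k) (a *+ (j == i :> nat) + b *+ (j == i.+1 :> nat)))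
    = a ^+ k.
Proof.
rewrite -det_tr det_trig.
  rewrite -[k in RHS]card_ord -prodr_const; apply: eq_bigr => i _.
  by rewrite !mxE eqxx (ltn_eqF (ltnSn i)) addr0.
apply/is_trig_mxP => i j lt_ij.
by rewrite !mxE (ltn_eqF lt_ij) (ltn_eqF (leqW lt_ij)) addr0.
Qed.

Lemma det_mxeval_KFin {C : numClosedFieldType} (r : nat) (a mu : C) :
  \det (mxeval mu (kb_mx (KFin r a))) = (mu - a) ^+ r.+1.
Proof.
rewrite mxeval_pencil -(det_bidiagonal _ (-1)); congr (\det _).
apply/matrixP => i j; rewrite !mxE eq_sym.
rewrite -[(j == i :> nat)]/(j == i) opprD mulNrn addrA -mulNrn.
by rewrite -!mulNrn mulrnBl mulr_natr mulNrn.
Qed.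

Lemma det_mxeval_KInf {C : numClosedFieldType} (s : nat) (mu : C) :
  \det (mxeval mu (kb_mx (@KInf C s))) = (-1) ^+ s.+1.
Proof.
rewrite mxeval_pencil -(det_bidiagonal _ mu); congr (\det _).
apply/matrixP => i j; rewrite !mxE eq_sym mul0rn add0r mulr_natr addrC.
by rewrite -mulNrn.
Qed.

Lemma det_neq0_ker0 {C : fieldType} {n p : nat} (A : 'M[C]_n)
    (x : 'M[C]_(n, p)) :
  \det A != 0 -> A *m x = 0 -> x = 0.
Proof.
by rewrite -unitfE => uA Ax; rewrite -(mulKmx uA x) Ax mulmx0.
Qed.

(** The canonical form is block diagonal, so its kernel can be studied one block
    at a time. *)
Lemma mxeval_kcf_cons {C : numClosedFieldType} {p : nat} (b : kblock C)
    (K : seq (kblock C)) (mu : C)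
    (y : 'M[C]_(kb_cols b, p)) (z : 'M[C]_(kcf_cols K, p)) :
  mxeval mu (kcf_mx (b :: K)) *m col_mx y z =
  col_mx (mxeval mu (kb_mx b) *m y) (mxeval mu (kcf_mx K) *m z).
Proof. by rewrite map_block_mx !map_mx0 mul_block_col !mul0mx addr0 add0r. Qed.

(** The block with eigenvalue [mu] is singular at [mu]; its kernel vector is
    extended by zero along the other blocks. *)
Lemma kcf_eigenvector {C : numClosedFieldType} (K : seq (kblock C)) (mu : C) :
  mu \in finite_eigenvalues K ->
  exists2 y : 'cV_(kcf_cols K), y != 0 & mxeval mu (kcf_mx K) *m y = 0.
Proof.
have in_tail b K' : (exists2 z : 'cV_(kcf_cols K'), z != 0 &
                       mxeval mu (kcf_mx K') *m z = 0) ->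
    exists2 y : 'cV_(kcf_cols (b :: K')), y != 0 &
      mxeval mu (kcf_mx (b :: K')) *m y = 0.
  case=> z z0 Kz; exists (col_mx 0 z); first by rewrite col_mx_eq0 eqxx.
  by rewrite mxeval_kcf_cons mulmx0 Kz col_mx0.
elim: K => [//|b K IH].
case: b => [e|e|r a|s];
  [by move/IH/in_tail | by move/IH/in_tail | | by move/IH/in_tail].
rewrite [_ \in _]inE => /predU1P[->|/IH/in_tail //].
have /eqP := det_mxeval_KFin r a a.
rewrite subrr expr0n /= -det_tr => /det0P[v v0 vA].
exists (col_mx v^T (0 : 'cV_(kcf_cols K))).
  by rewrite col_mx_eq0 eqxx andbT trmx_eq0.
apply: etrans (mxeval_kcf_cons (KFin r a) K a _ _) _.
by rewrite mulmx0 -[_ *m v^T]trmxK trmx_mul trmxK vA trmx0 col_mx0.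
Qed.

(** At a point [mu] outside the spectrum the blocks with a finite or infinite
    eigenvalue are invertible, and a zero left index gives a block without
    columns.  All of the kernel therefore comes from the zero right indices,
    whose blocks are zero columns independently of the evaluation point.  A
    block of right index [e > 0] would break this: its kernel vector
    [(1, mu, ..., mu^e)] moves with [mu]. *)
Lemma kcf_kernel_const {C : numClosedFieldType} (K : seq (kblock C)) (mu : C)
    (y : 'cV_(kcf_cols K)) :
  (forall e, e \in minimal_indices K -> e = 0%N) ->
  mu \notin finite_eigenvalues K ->
  mxeval mu (kcf_mx K) *m y = 0 ->
  forall nu : C, mxeval nu (kcf_mx K) *m y = 0.
Proof.
elim: K y => [|b K IH] y idx0 mu_eig Ky0 nu.
  by rewrite flatmx0 [RHS]flatmx0.
move: Ky0; rewrite -[y]vsubmxK !mxeval_kcf_cons.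
move/eqP; rewrite col_mx_eq0 => /andP[/eqP by0 /eqP Kz0].
rewrite IH //; first last.
- by case: b mu_eig {idx0 y by0 Kz0} => //= r a; rewrite inE negb_or => /andP[].
- case: b idx0 {mu_eig y by0 Kz0} => //= e idx0 d Kd;
    by apply: idx0; rewrite inE Kd orbT.
suff -> : mxeval nu (kb_mx b) *m usubmx y = 0 by rewrite col_mx0.
move: (usubmx y) by0.
case: b idx0 mu_eig {y Kz0} => [e|e|r a|s] /= idx0 mu_eig u bu0.
- have e0 : e = 0%N by apply: idx0; rewrite inE eqxx.
  by subst e; rewrite [LHS]flatmx0.
- have e0 : e = 0%N by apply: idx0; rewrite inE eqxx.
  by subst e; rewrite [u]flatmx0 mulmx0.
- rewrite (det_neq0_ker0 _ _ _ bu0) ?mulmx0 // det_mxeval_KFin expf_neq0 //.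
  by rewrite subr_eq0; move: mu_eig; rewrite inE negb_or => /andP[].
- by rewrite (det_neq0_ker0 _ _ _ bu0) ?mulmx0 // det_mxeval_KInf signr_eq0.
Qed.

(** Strict equivalence transports kernels through a matrix [T] that is the same
    at all evaluation points.  Both inverse identities are stated because the
    shape [kcf_cols K] of [T] is only propositionally equal to [n]. *)
Lemma kronecker_form_kernel {C : numClosedFieldType} {m n : nat}
    (P : 'M[{poly C}]_(m, n)) (K : seq (kblock C)) :
  kronecker_form P K ->
  exists T : 'M[C]_(n, kcf_cols K), exists U : 'M[C]_(kcf_cols K, n),
    [/\ T *m U = 1%:M, U *m T = 1%:M &
        forall (nu : C) (y : 'cV[C]_(kcf_cols K)),
          mxeval nu P *m (T *m y) = 0 <-> mxeval nu (kcf_mx K) *m y = 0].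
Proof.
case=> em [en [S [T [uS uT]]]].
case: m / em P S uS => P S uS; case: n / en P T uT => P T uT eqK.
exists T, (invmx T); split; [exact: mulmxV | exact: mulVmx |] => nu y.
rewrite -[kcf_mx K]/(castmx (erefl, erefl) (kcf_mx K)) -eqK.
rewrite !map_mxM !mxeval_const -!mulmxA; split => [->|]; first exact: mulmx0.
by move=> SPTy0; rewrite -[LHS](mulKmx uS) SPTy0 mulmx0.
Qed.

Lemma finite_eigenvalue_kernel {C : numClosedFieldType} {m n : nat}
    (P : 'M[{poly C}]_(m, n)) (K : seq (kblock C)) (mu : C) :
  kronecker_form P K -> mu \in finite_eigenvalues K ->
  exists2 x : 'cV[C]_n, x != 0 & mxeval mu P *m x = 0.
Proof.
case/kronecker_form_kernel=> T [U [_ UT kerP]] /kcf_eigenvector[y y0 Ky].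
exists (T *m y); last exact/kerP.
by apply: contra_neq y0 => Ty0; rewrite -[y]mul1mx -UT -mulmxA Ty0 mulmx0.
Qed.

Lemma kernel_const_of_indices0 {C : numClosedFieldType} {m n : nat}
    (A B : 'M[C]_(m, n)) (K : seq (kblock C)) (mu : C) (x : 'cV[C]_n) :
  kronecker_form (pencil A B) K ->
  (forall e, e \in minimal_indices K -> e = 0%N) ->
  mu \notin finite_eigenvalues K ->
  (mu *: A + B) *m x = 0 -> A *m x = 0 /\ B *m x = 0.
Proof.
case/kronecker_form_kernel=> T [U [TU _ kerP]] idx0 mu_eig ABx0.
have xE : x = T *m (U *m x) by rewrite mulmxA TU mul1mx.
have ker_all (nu : C) : (nu *: A + B) *m x = 0.
  rewrite xE -mxeval_pencil; apply/kerP/(kcf_kernel_const _ mu) => //.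
  by apply/kerP; rewrite mxeval_pencil -xE.
have Bx0 : B *m x = 0 by rewrite -(ker_all 0) scale0r add0r.
by split=> //; have := ker_all 1; rewrite scale1r mulmxDl Bx0 addr0.
Qed.

(** * Quadratic forms of skew-Hermitian and semidefinite matrices *)

Lemma qformD {C : numClosedFieldType} {n : nat} (A B : 'M[C]_n) (x : 'cV[C]_n) :
  qform (A + B) x = qform A x + qform B x.
Proof. by rewrite /qform mulmxDr mulmxDl mxE. Qed.

Lemma qformZ {C : numClosedFieldType} {n : nat} (a : C) (A : 'M[C]_n)
    (x : 'cV[C]_n) :
  qform (a *: A) x = a * qform A x.
Proof. by rewrite /qform -scalemxAr -scalemxAl mxE. Qed.

Lemma adjmxM {C : numClosedFieldType} {m n p : nat} (A : 'M[C]_(m, n))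
    (B : 'M[C]_(n, p)) :
  (A *m B)^t* = B^t* *m A^t*.
Proof. by rewrite trmx_mul map_mxM. Qed.

Lemma adjmxK {C : numClosedFieldType} {m n : nat} (A : 'M[C]_(m, n)) :
  A^t*^t* = A.
Proof. by apply/matrixP => i j; rewrite !mxE conjCK. Qed.

Lemma conj_qform {C : numClosedFieldType} {n : nat} (A : 'M[C]_n)
    (x : 'cV[C]_n) :
  (qform A x)^* = qform (A^t*) x.
Proof.
have -> : qform (A^t*) x = ((x^t* *m A *m x)^t*) 0 0.
  by rewrite !adjmxM adjmxK mulmxA.
by rewrite [RHS]mxE mxE.
Qed.

Lemma adjmx_mul_leif {C : numClosedFieldType} {n : nat} (v : 'cV[C]_n) :
  0 <= (v^t* *m v) 0 0 ?= iff (v == 0).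
Proof.
have -> : (v^t* *m v) 0 0 = \sum_i `|v i 0| ^+ 2.
  by rewrite mxE; apply: eq_bigr => i _; rewrite !mxE normCK mulrC.
have ge0 i : true -> 0 <= `|v i 0| ^+ 2 by rewrite exprn_ge0.
apply/leifP; have [->|v0] := eqVneq v 0.
  by rewrite big1 // => i _; rewrite mxE normr0 expr0n.
rewrite lt_neqAle sumr_ge0 // andbT eq_sym psumr_eq0 //.
apply: contra v0 => /allP v0; apply/eqP/matrixP => i j.
have := v0 i (mem_index_enum i).
by rewrite sqrf_eq0 normr_eq0 (ord1 j) mxE => /eqP.
Qed.

(** With [v = A x], [w = v^* v] and [c = v^* A v], the form at [x - t v] with
    [t] real is [- 2 t w + t^2 c].  It is nonnegative, but its linear term wins
    for small [t > 0] unless [w = 0]. *)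
Lemma psdmx_qform_eq0 {C : numClosedFieldType} {n : nat} (A : 'M[C]_n)
    (x : 'cV[C]_n) :
  psdmx A -> qform A x = 0 -> A *m x = 0.
Proof.
case=> A_herm A_ge0 qx0; pose v := A *m x.
pose w := (v^t* *m v) 0 0; pose c := qform A v.
have [w_ge0 w_eq0] := adjmx_mul_leif v; rewrite -/w in w_ge0 w_eq0.
have c_ge0 : 0 <= c by apply: A_ge0.
have c1_gt0 : 0 < c + 1 by rewrite ltr_wpDl.
(* The minimizer is w / c; adding 1 keeps the denominator positive when c = 0
   and leaves a step short enough to make the form negative. *)
pose t := w / (c + 1).
have tC : t^* = t by apply/CrealP/ger0_real; rewrite divr_ge0 // ltW.
have step_ge0 : 0 <= - (w ^+ 2 * (c + 2) / (c + 1) ^+ 2).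
  have -> : - (w ^+ 2 * (c + 2) / (c + 1) ^+ 2) = qform A (x - t *: v).
    have adj_step : (x - t *: v)^t* = x^t* - t *: v^t*.
      by apply/matrixP => i j; rewrite !mxE rmorphB rmorphM /= tC.
    have xA : x^t* *m A = v^t* by rewrite /v adjmxM A_herm.
    transitivity (- (t * w) - t * w + t ^+ 2 * c).
      by rewrite /t; field; rewrite gt_eqF.
    move: qx0; rewrite /qform adj_step mulmxBl xA -scalemxAl mulmxBl !mulmxBr.
    rewrite -!scalemxAl -(mulmxA _ A x) -/v -!scalemxAr /w /c /qform.
    move: (v^t* *m x) (v^t* *m v) (v^t* *m A *m v) => p q r p0.
    by rewrite !mxE p0; ring.
  exact: A_ge0.
apply/eqP; rewrite -[_ == _]w_eq0 eq_sym; apply: contraTT step_ge0 => w_neq0.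
rewrite oppr_ge0 lt_geF // divr_gt0 ?exprn_gt0 // mulr_gt0 //.
  by rewrite exprn_gt0 // lt_neqAle eq_sym w_neq0.
by rewrite ltr_wpDl.
Qed.

(** * Eigenvectors and the numerical condition *)

(** Multiplying the equation by the conjugate of [j1 + r1] and taking real parts
    gives [Re mu * |j1 + r1|^2 = - r1 r2 + j1 j2]: the product [j1 j2] of two
    imaginary numbers is real, and the mixed terms [r1 j2], [r2 j1] are
    imaginary. *)
Lemma Re_le0_of_numerical {C : numClosedFieldType} (mu r1 r2 j1 j2 : C) :
  r1^* = r1 -> r2^* = r2 -> j1^* = - j1 -> j2^* = - j2 ->
  - (r1 * r2) + j1 * j2 <= 0 -> mu * (j1 + r1) + (j2 + r2) = 0 ->
  j1 + r1 != 0 -> 'Re mu <= 0.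
Proof.
move=> r1C r2C j1C j2C num_le0 eig p_neq0.
have p_gt0 : 0 < `|j1 + r1| ^+ 2 by rewrite exprn_gt0 // normr_gt0.
rewrite -(pmulr_lle0 _ p_gt0) ReE normCK.
have eigC : mu^* * (r1 - j1) + (r2 - j2) = 0.
  by rewrite -[RHS](rmorph0 Num.conj) -eig !rmorphD rmorphM rmorphD /= r1C r2C
     j1C j2C ![- _ + _]addrC.
rewrite rmorphD /= j1C r1C.
have -> : (mu + mu^*) / 2 * ((j1 + r1) * (- j1 + r1)) =
  (- (r1 * r2) + j1 * j2)
  + ((mu * (j1 + r1) + (j2 + r2)) * (r1 - j1)
     + (mu^* * (r1 - j1) + (r2 - j2)) * (j1 + r1)) / 2.
  by field.
by rewrite eig eigC !mul0r addr0 mul0r addr0.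
Qed.

Lemma qform_psd_real {C : numClosedFieldType} {n : nat} (A : 'M[C]_n)
    (x : 'cV[C]_n) :
  psdmx A -> (qform A x)^* = qform A x.
Proof. by case=> A_herm _; rewrite conj_qform A_herm. Qed.

Lemma qform_skew_imaginary {C : numClosedFieldType} {n : nat} (A : 'M[C]_n)
    (x : 'cV[C]_n) :
  A^t* = - A -> (qform A x)^* = - qform A x.
Proof.
by move=> A_skew; rewrite conj_qform A_skew -scaleN1r qformZ mulN1r.
Qed.

(** The two summands of [qform (J + A) x] are its imaginary and real parts, so
    both vanish. *)
Lemma skew_psd_qform_eq0 {C : numClosedFieldType} {n : nat} (J A : 'M[C]_n)
    (x : 'cV[C]_n) :
  J^t* = - J -> psdmx A -> qform (J + A) x = 0 -> A *m x = 0.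
Proof.
move=> J_skew A_psd; rewrite qformD => JA0; apply: (psdmx_qform_eq0 _ _ A_psd).
have NJA0 : - qform J x + qform A x = 0.
  rewrite -(qform_skew_imaginary _ _ J_skew) -(qform_psd_real _ _ A_psd).
  by rewrite -rmorphD JA0 rmorph0.
have /eqP : qform A x *+ 2 = 0.
  transitivity ((qform J x + qform A x) + (- qform J x + qform A x)).
    by ring.
  by rewrite JA0 NJA0 addr0.
by rewrite mulrn_eq0 => /eqP.
Qed.

(** The only eigenvectors that escape the numerical estimate are those at which
    the quadratic form of the leading coefficient vanishes; then the trailing
    form vanishes as well. *)
Lemma eigenvector_Re_le0_or_kernel {C : numClosedFieldType} {n : nat}
    (J1 J2 R1 R2 : 'M[C]_n) (mu : C) (x : 'cV[C]_n) :
  J1^t* = - J1 -> J2^t* = - J2 -> psdmx R1 -> psdmx R2 ->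
  - (qform R1 x * qform R2 x) + qform J1 x * qform J2 x <= 0 ->
  (mu *: (J1 + R1) + (J2 + R2)) *m x = 0 ->
  'Re mu <= 0 \/ R1 *m x = 0 /\ R2 *m x = 0.
Proof.
move=> J1_skew J2_skew R1_psd R2_psd num_le0 Px0.
have num_eq : mu * qform (J1 + R1) x + qform (J2 + R2) x = 0.
  by rewrite -qformZ -qformD /qform -mulmxA Px0 mulmx0 mxE.
have [p0|p_neq0] := eqVneq (qform (J1 + R1) x) 0; last first.
  left; move: num_eq p_neq0; rewrite !qformD; apply: Re_le0_of_numerical => //;
    by [exact: qform_psd_real | exact: qform_skew_imaginary].
right; split; first exact: (skew_psd_qform_eq0 J1).
apply: (skew_psd_qform_eq0 J2) => //.
by move: num_eq; rewrite p0 mulr0 add0r.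
Qed.

Local Open Scope complex_scope.
Local Open Scope sesquilinear_scope.

Theorem theorem5p17 (R : realType) (n : nat) (J1 J2 R1 R2 : 'M[R[i]]_n)
    (J1_skew : J1^t* = - J1) (J2_skew : J2^t* = - J2)
    (R1_psd : psdmx R1) (R2_psd : psdmx R2)
    (num_cond : forall x : 'cV[R[i]]_n,
       - (qform R1 x * qform R2 x) + qform J1 x * qform J2 x <= 0)
    (P_regular : regular_pencil (pencil (J1 + R1) (J2 + R2)))
    (KJ : seq (kblock R[i])) (KJ_form : kronecker_form (pencil J1 J2) KJ)
    (KJ_indices : forall e, e \in minimal_indices KJ -> e = 0%N)
    (KJ_eigenvalues : forall mu : R[i],
       mu \in finite_eigenvalues KJ -> complex.Re mu <= 0)
    (KP : seq (kblock R[i]))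
    (KP_form : kronecker_form (pencil (J1 + R1) (J2 + R2)) KP) :
  forall mu : R[i], mu \in finite_eigenvalues KP -> complex.Re mu <= 0.
Proof.
move=> mu /(finite_eigenvalue_kernel _ _ _ KP_form)[x x_neq0].
rewrite mxeval_pencil => Px0.
have [Re_mu|[R1x0 R2x0]] := eigenvector_Re_le0_or_kernel _ _ _ _ _ _
  J1_skew J2_skew R1_psd R2_psd (num_cond x) Px0.
  by rewrite -lecR complexRe.
have [/KJ_eigenvalues // | mu_eig] := boolP (mu \in finite_eigenvalues KJ).
have [|J1x0 J2x0] :=
    kernel_const_of_indices0 _ _ _ _ x KJ_form KJ_indices mu_eig.
  by rewrite -Px0 scalerDr !mulmxDl -!scalemxAl R1x0 R2x0 scaler0 !addr0.
case/eqP: x_neq0; apply: (regular_pencil_ker0 _ _ _ P_regular).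
  by rewrite mulmxDl J1x0 R1x0 addr0.
by rewrite mulmxDl J2x0 R2x0 addr0.
Qed.
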